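(* Consider a finite Markov decision process with state space $\{1,\ldots,n\}$, action space $\{1,\ldots,l\}$, transition kernel $P((s,a),s')$, reward $R(s,a)$ and discount factor $\gamma\in(0,1)$, with Bellman optimality operator $T$ and optimal value function $J^*=T(J^* )$. Consider the switched affine system $J_{k+1}=\gamma P_{\sigma_k}J_k+R_{\sigma_k}$, $k\ge0$, with the switching sequence $\{\sigma_k\}$ completely determined by the Bellman optimality operator, so that $J_{k+1}=T(J_k)$ for all $k$. Suppose the sequence $\{J^u_k\}$ is generated by $J^u_{k+1}-J^*=\gamma P_{\sigma_k}(J^u_k-J^* )$ with the same switching sequence $\{\sigma_k\}$, and the sequence $\{J^o_k\}$ is generated by $J^o_{k+1}-J^*=\gamma P^*(J^o_k-J^* )$. Suppose $J_0=J^u_0=J^o_0$. Then $$J^o_k-J^*\le J_k-J^*\le J^u_k-J^*\qquad\text{for all }k\ge0.$$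
   Context: Vector inequalities are entrywise. The Bellman optimality operator $T:\mathbb{R}^n\to\mathbb{R}^n$ is $T(J)(s)=\max_{a\in\{1,\ldots,l\}}\left(R(s,a)+\gamma\sum_{s'=1}^nP((s,a),s')J(s')\right)$. Let $\mathbf{\Lambda}=\{(P_m,R_m):m=1,\ldots,l^n\}$ be the set of pairs indexed by all the choices of one action per state: for the choice $i\mapsto a_i$, the $i$-th row of $P_m\in\mathbb{R}^{n\times n}$ is $[P((i,a_i),1)\ \cdots\ P((i,a_i),n)]$ and the $i$-th entry of $R_m\in\mathbb{R}^n$ is $R(i,a_i)$. ''The switching sequence is completely determined by the Bellman optimality operator'' means that for each $k$, $\sigma_k\in\{1,\ldots,l^n\}$ is an index corresponding to a choice of a maximizing action in each state in the definition of $T(J_k)$, so $T(J_k)=\gamma P_{\sigma_k}J_k+R_{\sigma_k}$ and the trajectory coincides with the sequence generated by value iteration. $(P^*,R^* )\in\mathbf{\Lambda}$ denotes a pair such that $J^*=\gamma P^*J^*+R^*$. *)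

(* Defs.v *)
From mathcomp Require Import all_boot all_order all_algebra.
From mathcomp Require Import boolp classical_sets reals.

Set Implicit Arguments.
Unset Strict Implicit.
Unset Printing Implicit Defensive.

Import Order.TTheory GRing.Theory Num.Theory.
Local Open Scope ring_scope.

(* Discounted MDP with states 'I_n and actions 'I_l; [trans s a s'] is the
   probability P((s,a),s'). *)
Record mdp (R : realType) (n l : nat) := Mdp {
  trans : 'I_n -> 'I_l -> 'I_n -> R;
  reward : 'I_n -> 'I_l -> R;
  discount : R;
  trans_ge0 : forall s a s', 0 <= trans s a s';
  trans_sum1 : forall s a, \sum_(s' < n) trans s a s' = 1;
  discount_gt0 : 0 < discount;
  discount_lt1 : discount < 1
}.

Definition qvalue (R : realType) (n l : nat) (M : mdp R n l)
    (J : 'cV[R]_n) (s : 'I_n) (a : 'I_l) : R :=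
  reward M s a + discount M * \sum_(s' < n) trans M s a s' * J s' 0.

(* The action set is nonempty, hence [l.+1]; the seed [qvalue M J s ord0] is one
   of the maximized values, so this is the maximum over all actions. *)
Definition bellman (R : realType) (n l : nat) (M : mdp R n l.+1)
    (J : 'cV[R]_n) : 'cV[R]_n :=
  \col_(s < n) \big[Num.max/qvalue M J s ord0]_(a < l.+1) qvalue M J s a.

(* One action per state. The l ^ n policies serve directly as the indices m of
   the pairs (P_m, R_m), without numbering them 1, ..., l ^ n. *)
Definition policy (n l : nat) := {ffun 'I_n -> 'I_l}.

Lemma card_policy (n l : nat) : #|{: policy n l}| = (l ^ n)%N.
Proof. by rewrite card_ffun !card_ord. Qed.

Definition policy_mx (R : realType) (n l : nat) (M : mdp R n l)
    (d : policy n l) : 'M[R]_n := \matrix_(i, j) trans M i (d i) j.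

Definition policy_reward (R : realType) (n l : nat) (M : mdp R n l)
    (d : policy n l) : 'cV[R]_n := \col_i reward M i (d i).

Definition Lambda (R : realType) (n l : nat) (M : mdp R n l) :
    set ('M[R]_n * 'cV[R]_n) :=
  range (fun d : policy n l => (policy_mx M d, policy_reward M d)).

(* [d] picks, in every state, some action attaining the maximum in
   [bellman M J]; ties may be broken arbitrarily. *)
Definition greedy (R : realType) (n l : nat) (M : mdp R n l)
    (J : 'cV[R]_n) (d : policy n l) : Prop :=
  forall (s : 'I_n) (a : 'I_l), qvalue M J s a <= qvalue M J s (d s).

Definition vle (R : realType) (n : nat) (u v : 'cV[R]_n) : Prop :=
  forall i : 'I_n, u i 0 <= v i 0.

(* Main.v *)
(* Since every gamma P_d is a monotone map, both bounds follow by induction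
   from one-step comparisons: a greedy choice at J_k beats the optimal policy
   there, and Jstar, being a fixed point of T, dominates the one-step value of
   sigma_k at Jstar. *)
Require Import Defs.
From mathcomp Require Import all_boot all_order all_algebra.
From mathcomp Require Import boolp classical_sets reals.

Set Implicit Arguments.
Unset Strict Implicit.
Unset Printing Implicit Defensive.

Import Order.TTheory GRing.Theory Num.Theory.
Local Open Scope ring_scope.

Lemma vle_trans (R : realType) (n : nat) (v u w : 'cV[R]_n) :
  vle u v -> vle v w -> vle u w.
Proof. by move=> uv vw i; apply: le_trans (uv i) (vw i). Qed.

(** Bridge from the matrix dynamics to the Q-values, in which [greedy] and [bellman] are phrased. *)
Lemma policy_affineE (R : realType) (n l : nat) (M : mdp R n l)
    (d : policy n l) (J : 'cV[R]_n) (i : 'I_n) :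
  (discount M *: (policy_mx M d *m J) + policy_reward M d) i 0
  = qvalue M J i (d i).
Proof.
rewrite !mxE addrC; congr (_ + _ * _).
by apply: eq_bigr => j _; rewrite mxE.
Qed.

(** The reward depends only on the action, so it cancels between [J] and [J']; linear error dynamics
    thus become differences of Q-values. *)
Lemma qvalueB (R : realType) (n l : nat) (M : mdp R n l)
    (d : policy n l) (J J' : 'cV[R]_n) (i : 'I_n) :
  (discount M *: (policy_mx M d *m (J - J'))) i 0
  = qvalue M J i (d i) - qvalue M J' i (d i).
Proof.
rewrite -!policy_affineE mulmxBr scalerBr.
(* Abstracting the three vectors keeps [mxE] from expanding the matrix products into sums. *)
move: (_ *: _) (_ *: _) (policy_reward M d) => A B C.
by rewrite !mxE opprD addrACA subrr addr0.
Qed.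

(** Holds because the discount and all transition probabilities are nonnegative. *)
Lemma vle_discounted_policy_mx (R : realType) (n l : nat) (M : mdp R n l)
    (d : policy n l) (u v : 'cV[R]_n) :
  vle u v ->
  vle (discount M *: (policy_mx M d *m u)) (discount M *: (policy_mx M d *m v)).
Proof.
move=> uv i; rewrite !mxE; apply: ler_wpM2l; first exact/ltW/discount_gt0.
by apply: ler_sum => j _; rewrite mxE ler_wpM2l ?trans_ge0.
Qed.

Lemma qvalue_le_bellman (R : realType) (n l : nat) (M : mdp R n l.+1)
    (J : 'cV[R]_n) (s : 'I_n) (a : 'I_l.+1) :
  qvalue M J s a <= bellman M J s 0.
Proof. by rewrite mxE; apply: le_bigmax. Qed.

Theorem theorem2 (R : realType) (n l : nat) (M : mdp R n l.+1)
    (Jstar : 'cV[R]_n) (hJstar : Jstar = bellman M Jstar)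
    (Pstar : 'M[R]_n) (Rstar : 'cV[R]_n)
    (hLambda : Lambda M (Pstar, Rstar))
    (hPRstar : Jstar = discount M *: (Pstar *m Jstar) + Rstar)
    (sigma : nat -> policy n l.+1) (J Ju Jo : nat -> 'cV[R]_n)
    (hJ : forall k, J k.+1 =
       discount M *: (policy_mx M (sigma k) *m J k)
         + policy_reward M (sigma k))
    (hsigma : forall k, greedy M (J k) (sigma k))
    (hJu : forall k, Ju k.+1 - Jstar =
       discount M *: (policy_mx M (sigma k) *m (Ju k - Jstar)))
    (hJo : forall k, Jo k.+1 - Jstar =
       discount M *: (Pstar *m (Jo k - Jstar)))
    (hJu0 : J 0%N = Ju 0%N) (hJo0 : Ju 0%N = Jo 0%N) :
  forall k : nat,
    vle (Jo k - Jstar) (J k - Jstar) /\ vle (J k - Jstar) (Ju k - Jstar).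
Proof.
case: hLambda => d _ [defP defR].
have JstarE i : Jstar i 0 = qvalue M Jstar i (d i).
  by rewrite {1}hPRstar -defP -defR policy_affineE.
have qJstar_le i a : qvalue M Jstar i a <= Jstar i 0.
  by rewrite {2}hJstar qvalue_le_bellman.
have JE k i : J k.+1 i 0 = qvalue M (J k) i (sigma k i).
  by rewrite hJ policy_affineE.
elim=> [|k [IHo IHu]]; first by rewrite -hJo0 -hJu0; split=> i.
split.
(* The middle term is [d] applied to [J k - Jstar]: its entries are Q-values of [d] at [J k] minus
   [Jstar], and [sigma k] is greedy at [J k]. *)
- rewrite hJo -defP; apply: vle_trans (vle_discounted_policy_mx M d IHo) _ => i.
  by rewrite qvalueB !mxE -JstarE JE lerB ?hsigma.
(* Now [sigma k] is applied to [J k - Jstar]: subtracting its Q-value at [Jstar] removes at most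
   [Jstar]. *)
- rewrite hJu; apply: vle_trans _ (vle_discounted_policy_mx M (sigma k) IHu) => i.
  by rewrite qvalueB !mxE JE lerB ?qJstar_le.
Qed.
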